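(* For any positive integers $d$, $r$, $s$, and $t$ with $t>2r$ and $r>s$, $$bc_d(\mathrm{KG}(t,r))\geq bc_{m}(\mathrm{KG}(t,s)),$$ where $m=N((r-s,r-s;d),t-2s)$.
   Context: All graphs are finite and simple; $[t]=\{1,\ldots,t\}$. Kneser graph. The vertices of $\mathrm{KG}(t,r)$ are the $r$-element subsets of $[t]$; two distinct vertices $A,B$ are adjacent iff $A\cap B=\varnothing$. Biclique covers. A biclique is a bipartite graph with parts $(X,Y)$ in which every vertex of $X$ is adjacent to every vertex of $Y$; edgeless graphs are also regarded as bicliques. A $d$-biclique cover of size $k$ of a graph $G$ is a collection (family, repetitions allowed) of $k$ bicliques that are subgraphs (not necessarily induced) of $G$ such that each edge of $G$ is in at least $d$ of them. $bc_d(G)$ is the minimum $k$ for which a $d$-biclique cover of $G$ of size $k$ exists. Cover-free families. Let $X$ be a finite set with $n$ elements and $\mathcal F=\{B_1,\ldots,B_t\}$ an (indexed) family of $t$ subsets of $X$. $\mathcal F$ is an $(r,w;d)$-cover-free family if for all $I,J\subseteq[t]$ with $|I|=r$, $|J|=w$, $I\cap J=\varnothing$, the set $\bigcap_{i\in I}B_i\setminus\bigcup_{j\in J}B_j$ has at least $d$ elements. $N((r,w;d),t)$ is the minimum $n$ for which there exists an $(r,w;d)$-cover-free family of $t$ subsets of an $n$-element set. *)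

(* Defs.v *)
From HB Require Import structures.
From mathcomp Require Import all_boot.
Set Implicit Arguments.
Unset Strict Implicit.
Unset Printing Implicit Defensive.

Record sgraph := SGraph {
  vertex :> finType;
  adj : rel vertex;
  adj_sym : symmetric adj;
  adj_irrefl : irreflexive adj }.

Definition kneser_vertex (t r : nat) : finType := {A : {set 'I_t} | #|A| == r}.

Definition kneser_adj (t r : nat) : rel (kneser_vertex t r) :=
  fun A B => (A != B) && [disjoint val A & val B].

Lemma kneser_adj_sym (t r : nat) : symmetric (@kneser_adj t r).
Proof. by move=> A B; rewrite /kneser_adj eq_sym disjoint_sym. Qed.

Lemma kneser_adj_irrefl (t r : nat) : irreflexive (@kneser_adj t r).
Proof. by move=> A; rewrite /kneser_adj eqxx. Qed.

Definition KG (t r : nat) : sgraph :=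
  SGraph (@kneser_adj_sym t r) (@kneser_adj_irrefl t r).

Section BicliqueCover.
Variable G : sgraph.

(* A biclique subgraph of G is given by its two parts; its edges are all the
   pairs {x, y} with x in the first part and y in the second.  An edgeless
   subgraph on V is the pair (V, set0). *)
Definition is_biclique (K : {set G} * {set G}) : bool :=
  [disjoint K.1 & K.2] &&
  [forall x in K.1, [forall y in K.2, adj x y]].

Definition edge_in (K : {set G} * {set G}) (u v : G) : bool :=
  ((u \in K.1) && (v \in K.2)) || ((v \in K.1) && (u \in K.2)).

Definition is_biclique_cover (d k : nat)
    (F : {ffun 'I_k -> {set G} * {set G}}) : bool :=
  [forall i, is_biclique (F i)] &&
  [forall u, forall v, adj u v ==> (d <= #|[set i | edge_in (F i) u v]|)].

Definition has_biclique_cover (d k : nat) : bool :=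
  [exists F : {ffun 'I_k -> {set G} * {set G}}, is_biclique_cover d F].

(* The witness takes every single edge d times. *)
Lemma exists_biclique_cover (d : nat) : exists k, has_biclique_cover d k.
Proof.
pose I : finType := ((G * G) * 'I_d)%type.
pose F (a : I) : {set G} * {set G} :=
  if adj a.1.1 a.1.2 then ([set a.1.1], [set a.1.2]) else (set0, set0).
exists #|I|; apply/existsP; exists [ffun i => F (enum_val i)].
apply/andP; split.
  apply/forallP=> i; rewrite ffunE /F; case: ifP => [uv|_]; last first.
    apply/andP; split; first by rewrite -setI_eq0 setI0.
    by apply/forall_inP=> x; rewrite inE.
  apply/andP; split=> /=.
    by rewrite disjoints1 inE; apply: contraTneq uv => ->; rewrite adj_irrefl.
  by apply/forall_inP=> x /set1P->; apply/forall_inP=> y /set1P->.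
apply/forallP=> u; apply/forallP=> v; apply/implyP=> uv.
pose h (j : 'I_d) : 'I_#|I| := enum_rank (((u, v), j) : I).
have h_inj : injective h by move=> i j /enum_rank_inj[].
rewrite -[leqLHS]card_ord -(card_imset _ h_inj) subset_leq_card //.
apply/subsetP=> _ /imsetP[j _ ->].
by rewrite inE ffunE enum_rankK /F /edge_in /= uv /= !inE !eqxx.
Qed.

Definition bc (d : nat) : nat := ex_minn (exists_biclique_cover d).

End BicliqueCover.

Definition is_cover_free (r w d t n : nat)
    (B : {ffun 'I_t -> {set 'I_n}}) : bool :=
  [forall I : {set 'I_t}, forall J : {set 'I_t},
    [&& #|I| == r, #|J| == w & [disjoint I & J]] ==>
    (d <= #|(\bigcap_(i in I) B i) :\: (\bigcup_(j in J) B j)|)].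

Definition has_cover_free (r w d t n : nat) : bool :=
  [exists B : {ffun 'I_t -> {set 'I_n}}, is_cover_free r w d B].

(* The witness has d copies of each subset of 'I_t as points, the i-th block
   consisting of the copies of the subsets that contain i. *)
Lemma exists_cover_free (r w d t : nat) : exists n, has_cover_free r w d t n.
Proof.
pose P : finType := ({set 'I_t} * 'I_d)%type.
exists #|P|; apply/existsP.
exists [ffun i => [set p : 'I_#|P| | i \in (enum_val p).1]].
apply/forallP=> I; apply/forallP=> J; apply/implyP=> /and3P[_ _ dIJ].
pose h (j : 'I_d) : 'I_#|P| := enum_rank ((I, j) : P).
have h_inj : injective h by move=> i j /enum_rank_inj[].
rewrite -[leqLHS]card_ord -(card_imset _ h_inj) subset_leq_card //.
apply/subsetP=> _ /imsetP[j _ ->]; rewrite inE; apply/andP; split.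
  apply/bigcupP=> -[i iJ]; rewrite ffunE inE enum_rankK /= => iI.
  by rewrite (disjointFr dIJ iI) in iJ.
by apply/bigcapP=> i iI; rewrite ffunE inE enum_rankK.
Qed.

(* N r w d t is N((r,w;d),t). *)
Definition N (r w d t : nat) : nat := ex_minn (exists_cover_free r w d t).

(* Main.v *)
Require Import Defs.
From HB Require Import structures.
From mathcomp Require Import all_boot.
Set Implicit Arguments.
Unset Strict Implicit.
Unset Printing Implicit Defensive.

(** A biclique (X, Y) of [KG t r] only matters through the two ground sets
    P = union of X and Q = union of Y: each member of X is disjoint from each
    member of Y, so P and Q are disjoint, and hence all s-subsets of P against
    all s-subsets of Q form a biclique of [KG t s].  Doing this to each member
    of an optimal d-cover of [KG t r] gives equally many bicliques of
    [KG t s]; it remains to count how many of them contain a given edge UV.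

    Let E be the set of indices i whose new biclique contains UV, and let T be
    the complement of U :|: V, which has t - 2s points.  Name the two ground
    sets of i in E so that U lies in the first and V in the second, and
    attach to x in T the block of those i in E whose first set contains x.
    For disjoint (r-s)-subsets I, J of T, the pair (U :|: I, V :|: J) is an
    edge of [KG t r], so it lies in at least d of the old bicliques.  Each of
    their indices is in E, has I inside its first set and J inside the second,
    so it lies in all blocks of I and in no block of J.  The blocks thus form
    an (r-s, r-s; d)-cover-free family of t - 2s subsets of E, which forces
    #|E| >= N (r-s) (r-s) d (t - 2s) ([N_le_card], [leq_N_card_lifted]). *)

Lemma bc_le (G : sgraph) d k (F : {ffun 'I_k -> {set G} * {set G}}) :
  is_biclique_cover d F -> bc G d <= k.
Proof.
move=> covF; rewrite /bc; case: ex_minnP => m _; apply.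
by apply/existsP; exists F.
Qed.

(** Frees the definition of [N] from ordinals: the family may be indexed by any
    finite set [T], with points in any finite set [E].  The blocks [B x] need
    not lie inside [E], since only their traces on [E] are counted. *)
Lemma N_le_card (V K : finType) (T : {set V}) (E : {set K}) (B : V -> {set K})
    r w d :
  (forall I J : {set V}, I \subset T -> J \subset T -> #|I| = r -> #|J| = w ->
     [disjoint I & J] ->
     d <= #|E :&: (\bigcap_(x in I) B x :\: \bigcup_(x in J) B x)|) ->
  N r w d #|T| <= #|E|.
Proof.
move=> cfB; rewrite /N; case: ex_minnP => m _; apply.
apply/existsP.
exists [ffun j => [set p : 'I_#|E| | enum_val p \in B (enum_val j)]].
apply/forallP=> I; apply/forallP=> J; apply/implyP=> /and3P[].
move=> /eqP cI /eqP cJ dIJ.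
pose im (A : {set 'I_#|T|}) : {set V} := [set enum_val j | j in A].
have imT A : im A \subset T.
  by apply/subsetP=> _ /imsetP[j _ ->]; apply: enum_valP.
have im_inj A : #|im A| = #|A| by apply/card_imset/enum_val_inj.
have dim : [disjoint im I & im J].
  apply/pred0P=> x /=; apply/negbTE/andP=> -[/imsetP[i iI ->] /imsetP[j jJ]].
  by move/enum_val_inj=> ij; rewrite -ij (disjointFr dIJ iI) in jJ.
apply: leq_trans (cfB _ _ (imT I) (imT J) _ _ dim) _; rewrite ?im_inj //.
apply: leq_trans (leq_imset_card (fun p : 'I_#|E| => enum_val p) _).
apply/subset_leq_card/subsetP=> y /setIP[yE /setDP[/bigcapP yI /bigcupP yJ]].
apply/imsetP; exists (enum_rank_in yE y); last by rewrite enum_rankK_in.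
apply/setDP; split.
  by apply/bigcapP=> i iI; rewrite ffunE inE enum_rankK_in // yI ?imset_f.
apply/bigcupP=> -[j jJ]; rewrite ffunE inE enum_rankK_in // => yj.
by apply: yJ; exists (enum_val j); rewrite ?imset_f.
Qed.

Definition ground t r (X : {set KG t r}) : {set 'I_t} := \bigcup_(A in X) val A.

Lemma ground_sup t r (X : {set KG t r}) (A : KG t r) :
  A \in X -> val A \subset ground X.
Proof. exact: bigcup_sup. Qed.

Lemma biclique_ground_disjoint t r (K : {set KG t r} * {set KG t r}) :
  is_biclique K -> [disjoint ground K.1 & ground K.2].
Proof.
case/andP=> _ /forall_inP adjK; apply/pred0P=> x /=; apply/negbTE/andP.
case=> /bigcupP[A AK xA] /bigcupP[C CK xC].
have /andP[_ dAC] := forall_inP (adjK A AK) C CK.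
by rewrite (disjointFr dAC xA) in xC.
Qed.

Lemma adj_disjoint t r (A C : KG t r) : adj A C -> [disjoint val A & val C].
Proof. by case/andP. Qed.

Lemma disjoint_adj t r (A C : KG t r) :
  0 < r -> [disjoint val A & val C] -> adj A C.
Proof.
move=> r_gt0 dAC; apply/andP; split=> //; apply: contraTneq dAC => ->.
by rewrite -setI_eq0 setIid -card_gt0 (eqP (valP C)).
Qed.

Definition lifted t r s (K : {set KG t r} * {set KG t r}) :
    {set KG t s} * {set KG t s} :=
  ([set A : KG t s | val A \subset ground K.1],
   [set A : KG t s | val A \subset ground K.2]).

Lemma lifted_biclique t r s (K : {set KG t r} * {set KG t r}) :
  0 < s -> is_biclique K -> is_biclique (lifted s K).
Proof.
move=> s_gt0 /biclique_ground_disjoint dK.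
have adjL (A C : KG t s) :
    A \in (lifted s K).1 -> C \in (lifted s K).2 -> adj A C.
  rewrite !inE => sA sC; apply: disjoint_adj => //.
  exact: disjointWl sA (disjointWr sC dK).
apply/andP; split; last first.
  by apply/forall_inP=> A AK; apply/forall_inP=> C; apply: adjL.
apply/pred0P=> A /=; apply/negbTE/andP=> -[A1 A2].
by have := adjL A A A1 A2; rewrite adj_irrefl.
Qed.

(** Extending the edge UV to r-sets by disjoint I and J must again give a covered
    edge, for all choices of I and J off UV; that is exactly the cover-free
    property for the blocks recording, at each point off UV, the bicliques which
    have this point on the same side as U. *)
Lemma leq_N_card_lifted d r s t k
    (F : {ffun 'I_k -> {set KG t r} * {set KG t r}}) (U V : KG t s) :
  0 < s -> s < r -> is_biclique_cover d F -> adj U V ->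
  N (r - s) (r - s) d (t - 2 * s) <= #|[set i | edge_in (lifted s (F i)) U V]|.
Proof.
move=> s_gt0 lt_sr /andP[/forallP bicF /forallP covF] /adj_disjoint dUV.
have cU : #|val U| = s := eqP (valP U); have cV : #|val V| = s := eqP (valP V).
have -> : t - 2 * s = #|~: (val U :|: val V)|.
  have := leq_card_setU (val U) (val V); rewrite dUV => -[_ /eqP cUV].
  by rewrite cardsCs setCK cUV cU cV card_ord mul2n addnn.
(* As U is nonempty and the ground sets are disjoint, testing whether U lies in
   the left one determines the orientation of the biclique along UV. *)
pose B (x : 'I_t) := [set i | x \in
  if val U \subset ground (F i).1 then ground (F i).1 else ground (F i).2].
apply: (N_le_card (B := B)) => I J sIT sJT cI cJ dIJ.
have off (A : {set 'I_t}) : A \subset ~: (val U :|: val V) ->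
    [disjoint val U & A] /\ [disjoint val V & A].
  rewrite -disjoints_subset disjoint_sym -setI_eq0 setIUl setU_eq0 !setI_eq0.
  by move/andP.
have [dUI dVI] := off I sIT; have [dUJ dVJ] := off J sJT.
have cardUr (A C : {set 'I_t}) :
    #|A| = s -> #|C| = r - s -> [disjoint A & C] -> #|A :|: C| == r.
  move=> cA cC dAC; have := leq_card_setU A C; rewrite dAC => -[_ /eqP->].
  by rewrite cA cC subnKC // ltnW.
pose UI : KG t r := Sub (val U :|: I) (cardUr _ _ cU cI dUI).
pose VJ : KG t r := Sub (val V :|: J) (cardUr _ _ cV cJ dVJ).
have adjUV : adj UI VJ.
  apply: disjoint_adj; first exact: leq_ltn_trans lt_sr.
  rewrite !SubK -setI_eq0 setIUl !setIUr !setU_eq0 !setI_eq0 dUV dUJ dIJ.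
  by rewrite disjoint_sym dVI.
apply: leq_trans (implyP (forallP (covF UI) VJ) adjUV) _.
apply/subset_leq_card/subsetP=> i; rewrite inE => edgei.
have dPQ := biclique_ground_disjoint (bicF i).
have sub_ground (X : {set KG t r}) (A : KG t r) (C D : {set 'I_t}) :
    val A = C :|: D -> A \in X -> C \subset ground X /\ D \subset ground X.
  by move=> defA /ground_sup; rewrite defA subUset => /andP[].
(* P plays the ground set that contains U.  It is the left or the right one
   according to the orientation, and the two cases below are mirror images. *)
have blocks (P : {set 'I_t}) (Q : {set 'I_t}) :
    [disjoint P & Q] -> I \subset P -> J \subset Q ->
    (forall x, (i \in B x) = (x \in P)) ->
    i \in \bigcap_(x in I) B x :\: \bigcup_(x in J) B x.
  move=> dP /subsetP sI /subsetP sJ BP; apply/setDP; split.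
    by apply/bigcapP=> x /sI; rewrite BP.
  by apply/bigcupP=> -[x /sJ xQ]; rewrite BP (disjointFl dP xQ).
rewrite inE; apply/andP; split; case/orP: edgei => /andP[].
- move=> /(sub_ground _ _ _ _ (SubK _ _))[sU _]
         /(sub_ground _ _ _ _ (SubK _ _))[sV _].
  by rewrite inE /edge_in !inE sU sV.
- move=> /(sub_ground _ _ _ _ (SubK _ _))[sV _]
         /(sub_ground _ _ _ _ (SubK _ _))[sU _].
  by rewrite inE /edge_in !inE sU sV orbT.
- move=> /(sub_ground _ _ _ _ (SubK _ _))[sU sI]
         /(sub_ground _ _ _ _ (SubK _ _))[_ sJ].
  by apply: blocks dPQ sI sJ _ => x; rewrite inE sU.
- move=> /(sub_ground _ _ _ _ (SubK _ _))[_ sJ]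
         /(sub_ground _ _ _ _ (SubK _ _))[sU sI].
  have nsU : ~~ (val U \subset ground (F i).1).
    have /card_gt0P[x xU] : 0 < #|val U| by rewrite cU.
    apply/subsetPn; exists x => //.
    by rewrite (disjointFl dPQ (subsetP sU x xU)).
  rewrite disjoint_sym in dPQ.
  by apply: blocks dPQ sI sJ _ => x; rewrite inE (negbTE nsU).
Qed.

Theorem theorem3 (d r s t : nat)
  (d_gt0 : 0 < d) (r_gt0 : 0 < r) (s_gt0 : 0 < s) (t_gt0 : 0 < t)
  (lt_2r_t : 2 * r < t) (lt_s_r : s < r) :
  bc (KG t s) (N (r - s) (r - s) d (t - 2 * s)) <= bc (KG t r) d.
Proof.
rewrite [leqRHS]/bc; case: ex_minnP => k /existsP[F covF] _.
apply: (@bc_le _ _ _ [ffun i => lifted s (F i)]); apply/andP; split.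
  apply/forallP=> i; rewrite ffunE lifted_biclique //.
  by case/andP: covF => /forallP.
apply/forallP=> U; apply/forallP=> V; apply/implyP=> UV.
under eq_finset => i do rewrite ffunE.
exact: leq_N_card_lifted.
Qed.
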